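(* Let $\lambda_1=0<\lambda_2\le\dots\le\lambda_n$ be the eigenvalues of the scaled Laplacian $\boldsymbol L=\boldsymbol R^{-1/2}\boldsymbol L_{\mathrm B}\boldsymbol R^{-1/2}$, let $\hat g_{\mathrm o}(s)$ and $\hat c_{\mathrm o}(s)$ be the representative generator and inverter transfer functions, and for $k\in\{1,\dots,n\}$ let $$\hat z_k(s)=\frac{\hat g_{\mathrm o}(s)}{1+\hat g_{\mathrm o}(s)\left(\lambda_k/s-\hat c_{\mathrm o}(s)\right)}.$$ For $\lambda>0$ let $$\mathcal F(\hat z_1(s)/s,\lambda)=\frac{\hat z_1(s)/s}{1+\lambda \hat z_1(s)/s}$$ be the negative feedback interconnection of $\hat z_1(s)/s$ and the scalar gain $\lambda$. Suppose $\hat c_{\mathrm o}(s)$ is such that for every $\lambda>0$ all poles of $\mathcal F(\hat z_1(s)/s,\lambda)$ lie in the open left half-plane $\{\mathrm{Re}(s)<0\}$. Then, for every $k\in\{2,\dots,n\}$, the poles of $\hat z_k(s)$ are exactly the points that yield the gain $\lambda=\lambda_k$ on the root locus of the system with open-loop transfer function $\hat L(s)=\lambda\hat z_1(s)/s$ (with $\lambda$ as the variable gain); that is, the poles of $\hat z_k(s)$ are exactly the poles of $\mathcal F(\hat z_1(s)/s,\lambda_k)$.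
   Context: Power network model: $n\ge 2$ buses, connected network. $\boldsymbol L_{\mathrm B}\in\mathbb R^{n\times n}$ is the undirected weighted Laplacian matrix of the connected network (symmetric, positive semidefinite, kernel spanned by the all-ones vector). Bus $i$ has a generator transfer function $\hat g_i(s)$ and an inverter control transfer function $\hat c_i(s)$. Proportionality assumption: there are $r_i>0$ with $\hat g_i(s)=\hat g_{\mathrm o}(s)/r_i$ and $\hat c_i(s)=r_i\hat c_{\mathrm o}(s)$ for all $i$, where $\hat g_{\mathrm o}$ (representative generator, nonzero) and $\hat c_{\mathrm o}$ (representative inverter) are real rational functions of $s$. $\boldsymbol R=\mathrm{diag}(r_1,\dots,r_n)$. All feedback interconnections written are assumed well defined (denominators not identically zero as rational functions). Root locus of the system with open-loop transfer function $\lambda G(s)$ ($G$ rational): the set of closed-loop poles of $G(s)/(1+\lambda G(s))$, equivalently of solutions of $1+\lambda G(s)=0$ (after cancellation of common factors in $G$), as the gain $\lambda$ varies over positive values. A point yields the gain $\lambda=\lambda_k$ if it is a closed-loop pole for that value of $\lambda$. Poles of a rational function are understood after cancellation of common factors. *)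

(* Defs.v *)
From HB Require Import structures.
From mathcomp Require Import all_boot all_order all_algebra.
From mathcomp Require Import reals.
From mathcomp Require Import complex.

Set Implicit Arguments.
Unset Strict Implicit.
Unset Printing Implicit Defensive.

Import Order.TTheory GRing.Theory Num.Theory.
Local Open Scope ring_scope.

Section RationalFunctions.
Variable R : realType.
Implicit Types (f G : {fraction {poly R}}) (lambda : R) (p : R[i]).

Definition laplace_var : {fraction {poly R}} := tofrac 'X.

Definition ratconst lambda : {fraction {poly R}} := tofrac lambda%:P.

(* The fraction is put in lowest terms first; coprimality over R and over R[i]
   coincide, so the choice of the reduced pair is immaterial. *)
Definition is_pole f p : Prop :=
  exists a b : {poly R},
    [/\ b != 0, coprimep a b, f = tofrac a / tofrac b
      & root (map_poly (real_complex R) b) p].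

Definition feedback G lambda : {fraction {poly R}} :=
  G / (1 + ratconst lambda * G).

Definition feedback_wd G lambda : Prop := 1 + ratconst lambda * G != 0.

Definition yields_gain G lambda p : Prop :=
  0 < lambda /\ is_pole (feedback G lambda) p.

Definition zhat_den (go co : {fraction {poly R}}) lambda :
    {fraction {poly R}} :=
  1 + go * (ratconst lambda / laplace_var - co).

Definition zhat (go co : {fraction {poly R}}) lambda : {fraction {poly R}} :=
  go / zhat_den go co lambda.

End RationalFunctions.

Section Network.
Variables (R : realType) (n : nat).

(* Self-weights [w i i] play no role. *)
Definition laplacian (w : 'I_n -> 'I_n -> R) : 'M[R]_n :=
  \matrix_(i, j) (if i == j then \sum_(l < n | l != i) w i l else - w i j).

Definition connected_laplacian (LB : 'M[R]_n) : Prop :=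
  exists w : 'I_n -> 'I_n -> R,
    [/\ forall i j, w i j = w j i,
        forall i j, 0 <= w i j,
        forall i j, connect (fun k l => 0 < w k l) i j
      & LB = laplacian w].

Definition scaled_laplacian (r : 'I_n -> R) (LB : 'M[R]_n) : 'M[R]_n :=
  let D := diag_mx (\row_i (Num.sqrt (r i))^-1) in D *m LB *m D.

(* [lambda 1, ..., lambda n] are the eigenvalues of [A] with multiplicity, in
   nondecreasing order; the values of [lambda] at other indices are junk. *)
Definition ordered_eigenvalues (A : 'M[R]_n) (lambda : nat -> R) : Prop :=
  char_poly A = \prod_(1 <= k < n.+1) ('X - (lambda k)%:P) /\
  forall i j : nat, (1 <= i)%N -> (i <= j)%N -> (j <= n)%N ->
    lambda i <= lambda j.

Definition proportional (r : 'I_n -> R) (g c : 'I_n -> {fraction {poly R}})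
    (go co : {fraction {poly R}}) : Prop :=
  forall i, [/\ 0 < r i, g i = go / ratconst (r i)
              & c i = ratconst (r i) * co].

End Network.

(* Main.v *)
(* Since [lambda 1 = 0], clearing denominators gives
   [zhat_k = s * F(zhat_1 / s, lambda_k)], where [lambda_k > 0].  The stability
   hypothesis excludes a pole of [F] at [s = 0], so the factor [s] cancels none
   of its poles.  That [0] is a simple eigenvalue of the scaled Laplacian [A]
   with kernel vector [w] is seen by deflation:
   [char_poly A * (X - |w|^2) = X * char_poly (A + w w^T)], where [A + w w^T]
   is positive definite by connectedness. *)

Require Import Defs.
From HB Require Import structures.
From mathcomp Require Import all_boot all_order all_algebra.
From mathcomp Require Import reals.
From mathcomp Require Import complex.
From mathcomp Require Import ring.

Set Implicit Arguments.
Unset Strict Implicit.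
Unset Printing Implicit Defensive.

Import Order.TTheory GRing.Theory Num.Theory.
Local Open Scope ring_scope.

(** * Rank-one updates and characteristic polynomials *)

Lemma char_poly_rank1 (R : idomainType) (n : nat) (w : 'cV[R]_n)
    (u : 'rV[R]_n) :
  char_poly (w *m u) * 'X = 'X^n * ('X - ((u *m w) 0 0)%:P).
Proof.
pose W := map_mx polyC w; pose U := map_mx polyC u.
(* The determinant of this bordered matrix is computed twice: eliminating with the corner 1 leaves
   ['X - w u], while clearing [W] against ['X%:M] leaves ['X - u w]. The second column operation has
   determinant ['X], which accounts for the extra factor. *)
pose B : 'M[{poly R}]_(1 + n) := block_mx 1%:M U W 'X%:M.
have dB : \det B = char_poly (w *m u).
  have -> : B = block_mx 1%:M 0 W 1%:M *m
                block_mx 1%:M U 0 (char_poly_mx (w *m u)).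
    rewrite mulmx_block !mul1mx !mul0mx !mulmx1 !addr0 /char_poly_mx.
    by rewrite map_mxM addrC subrK.
  by rewrite det_mulmx det_lblock det_ublock !det1 !mul1r.
have dBX : \det (B *m block_mx 'X%:M 0 (- W) 1%:M)
    = ('X - ((u *m w) 0 0)%:P) * 'X^n.
  rewrite mulmx_block !mul1mx !mulmx0 !mulmx1 !add0r !mulmxN.
  rewrite mul_mx_scalar mul_scalar_mx subrr det_ublock det_scalar det_mx11.
  by rewrite -map_mxM !mxE.
by rewrite -dB mulrC -[RHS]mulrC -dBX det_mulmx det_lblock det_scalar1 det1
  mulr1 mulrC.
Qed.

(** Since [A w = 0], the product [('X - A) ('X - w u)] loses its term [A w u] and equals
    ['X ('X - (A + w u))]. Taking determinants and inserting the rank-one formula leaves a common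
    factor ['X^n] to cancel. *)
Lemma char_poly_deflation (R : idomainType) (n : nat) (A : 'M[R]_n)
    (w : 'cV[R]_n) (u : 'rV[R]_n) :
  A *m w = 0 ->
  char_poly A * ('X - ((u *m w) 0 0)%:P) = 'X * char_poly (A + w *m u).
Proof.
move=> Aw0.
have prodE : char_poly_mx A *m char_poly_mx (w *m u)
    = 'X *: char_poly_mx (A + w *m u).
  rewrite /char_poly_mx mulmxBl !mulmxBr -[map_mx _ A *m map_mx _ _]map_mxM.
  rewrite mulmxA Aw0 mul0mx map_mx0 subr0 map_mxD !mul_mx_scalar.
  by rewrite !mul_scalar_mx -!scalerBr opprD addrA addrAC.
have := congr1 determinant prodE; rewrite det_mulmx detZ -/(char_poly _).
rewrite -/(char_poly (w *m u)) -/(char_poly (A + _)) => dE.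
apply: (@mulfI _ 'X^n); first by rewrite monic_neq0 // monicXn.
by rewrite mulrCA -char_poly_rank1 mulrA dE mulrAC mulrA.
Qed.

Lemma rV_sqr (R : realDomainType) (n : nat) (v : 'rV[R]_n) :
  (v *m v^T) 0 0 = \sum_i v 0 i ^+ 2.
Proof. by rewrite mxE; apply: eq_bigr => i _; rewrite mxE expr2. Qed.

Lemma rV_sqr_gt0 (R : realDomainType) (n : nat) (v : 'rV[R]_n) :
  v != 0 -> 0 < (v *m v^T) 0 0.
Proof.
move=> v0; rewrite rV_sqr lt0r sumr_ge0 ?andbT => [|i _]; last exact: sqr_ge0.
apply: contra v0; rewrite psumr_eq0 => [|i _]; last exact: sqr_ge0.
move=> /allP v0; apply/eqP/rowP => i; rewrite mxE; apply/eqP.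
by have := v0 i (mem_index_enum _); rewrite /= sqrf_eq0.
Qed.

(** * The quadratic form of a graph Laplacian *)

Section LaplacianForm.
Variables (R : realType) (n : nat) (w : 'I_n -> 'I_n -> R).
Hypothesis wC : forall i j, w i j = w j i.

(** On the diagonal [w i i] is added to the sum and subtracted again, which removes the side
    condition [l != i]. *)
Lemma laplacianE i j :
  laplacian w i j = (i == j)%:R * (\sum_l w i l) - w i j.
Proof.
rewrite mxE; case: eqP => [<-|_]; last by rewrite mul0r sub0r.
by rewrite mul1r [in RHS](bigD1 i) //= addrC addrK.
Qed.

Lemma laplacian_const : laplacian w *m const_mx 1 = 0 :> 'cV_n.
Proof.
apply/matrixP => i j; rewrite !mxE.
under eq_bigr do rewrite laplacianE [const_mx _ _ _]mxE mulr1.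
rewrite sumrB (bigD1 i) //= eqxx mul1r [X in _ + X - _]big1 ?addr0 ?subrr // => k.
by rewrite eq_sym => /negPf ->; rewrite mul0r.
Qed.

(** The factor 2 appears because the sum over ordered pairs meets each edge twice. Expanding the
    squares gives [2 S - 2 T], the two square terms agreeing by symmetry of [w]. *)
Lemma laplacian_form (x : 'rV[R]_n) :
  (x *m laplacian w *m x^T) 0 0 *+ 2
    = \sum_i \sum_j w i j * (x 0 i - x 0 j) ^+ 2.
Proof.
pose S := \sum_i \sum_j w i j * x 0 i ^+ 2.
pose T := \sum_i \sum_j w i j * x 0 i * x 0 j.
have -> : (x *m laplacian w *m x^T) 0 0 = S - T.
  rewrite mxE -sumrB.
  under eq_bigr => j _ do rewrite [(_ *m _) _ _]mxE [x^T _ _]mxE mulr_suml.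
  rewrite exchange_big /=; apply: eq_bigr => i _.
  under eq_bigr => j _ do rewrite laplacianE mulrBr mulrBl.
  rewrite sumrB; congr (_ - _); last by apply: eq_bigr => j _; ring.
  rewrite (bigD1 i) //= [X in _ + X]big1 => [|j].
    by rewrite eqxx -mulr_suml mul1r; ring.
  by rewrite eq_sym => /negPf ->; rewrite mul0r mulr0 mul0r.
have S' : S = \sum_i \sum_j w i j * x 0 j ^+ 2.
  rewrite /S exchange_big; apply: eq_bigr => i _; apply: eq_bigr => j _.
  by rewrite wC.
rewrite mulr2n {2}S' /S /T addrACA -!opprD -!big_split /= -sumrB.
apply: eq_bigr => i _.
by rewrite -!big_split /= -sumrB; apply: eq_bigr => j _; ring.
Qed.

Hypothesis w_ge0 : forall i j, 0 <= w i j.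

Lemma laplacian_form_ge0 (x : 'rV[R]_n) :
  0 <= (x *m laplacian w *m x^T) 0 0.
Proof.
rewrite -(pmulrn_lge0 _ (isT : (0 < 2)%N)) laplacian_form.
by do 2!apply: sumr_ge0 => ? _; rewrite mulr_ge0 ?sqr_ge0.
Qed.

Hypothesis w_conn : forall i j, connect (fun k l => 0 < w k l) i j.

(** A vanishing sum of nonnegative terms makes [x] agree across every edge of positive weight;
    induction along a connecting path does the rest. *)
Lemma laplacian_form_eq0 (x : 'rV[R]_n) :
  (x *m laplacian w *m x^T) 0 0 = 0 -> forall i j, x 0 i = x 0 j.
Proof.
move=> x0 i j; have := laplacian_form x; rewrite x0 mul0rn => /esym/eqP.
have ge0 k l : 0 <= w k l * (x 0 k - x 0 l) ^+ 2 by rewrite mulr_ge0 ?sqr_ge0.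
rewrite psumr_eq0 => [/allP s0|k _]; last exact: sumr_ge0.
have step k l : 0 < w k l -> x 0 k = x 0 l.
  move=> wkl; have := s0 k (mem_index_enum _).
  rewrite /= psumr_eq0 // => /allP/(_ l (mem_index_enum _)) /=.
  by rewrite mulf_eq0 gt_eqF //= sqrf_eq0 subr_eq0 => /eqP.
have /connectP[p] := w_conn i j.
elim: p i => [|k p IHp] i /=; first by move=> _ ->.
by case/andP=> /step -> pk /(IHp _ pk).
Qed.

End LaplacianForm.

(** * Spectrum of the scaled Laplacian near 0 *)

Section ScaledLaplacian.
Variables (R : realType) (n : nat) (LB : 'M[R]_n) (r : 'I_n -> R).
Hypotheses (hLB : connected_laplacian LB) (r_gt0 : forall i, 0 < r i).

Let D : 'M[R]_n := diag_mx (\row_i (Num.sqrt (r i))^-1).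
Let w : 'cV[R]_n := \col_i Num.sqrt (r i).
Let A := scaled_laplacian r LB.

Let s_neq0 i : Num.sqrt (r i) != 0.
Proof. by rewrite gt_eqF // sqrtr_gt0. Qed.

Lemma scaled_laplacian_kernel : A *m w = 0.
Proof.
have [W [_ _ _ LBE]] := hLB.
rewrite /A /scaled_laplacian LBE -/D -!mulmxA.
have -> : D *m w = const_mx 1.
  by apply/matrixP=> i j; rewrite mul_diag_mx !mxE mulVf.
by rewrite laplacian_const mulmx0.
Qed.

Lemma scaled_laplacian_form (v : 'rV[R]_n) :
  v *m A *m v^T = (v *m D) *m LB *m (v *m D)^T.
Proof. by rewrite trmx_mul tr_diag_mx !mulmxA. Qed.

Lemma scaled_laplacian_form_ge0 (v : 'rV[R]_n) : 0 <= (v *m A *m v^T) 0 0.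
Proof.
have [W [WC W0 _ LBE]] := hLB; rewrite scaled_laplacian_form LBE.
exact: laplacian_form_ge0.
Qed.

Lemma scaled_laplacian_root_ge0 a : root (char_poly A) a -> 0 <= a.
Proof.
rewrite -eigenvalue_root_char => /eigenvalueP[v vA v0].
have := scaled_laplacian_form_ge0 v.
by rewrite vA -scalemxAl mxE pmulr_lge0 // rV_sqr_gt0.
Qed.

Lemma scaled_laplacian_deflated_unit : \det (A + w *m w^T) != 0.
Proof.
apply/negP => /det0P[v v0 vB].
(* Pairing [v (A + w w^T) = 0] with [v] gives a sum of two nonnegative numbers, so both vanish. *)
have form0 : (v *m A *m v^T) 0 0 + (v *m w) 0 0 ^+ 2 = 0.
  have := congr1 (fun M : 'rV_n => (M *m v^T) 0 0) vB.
  rewrite mul0mx mulmxDr mulmxDl mxE [RHS]mxE (mulmxA v w)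
    -[v *m w *m _ *m _]mulmxA -trmx_mul.
  by rewrite [X in _ + X]mxE big_ord1 [_^T _ _]mxE expr2.
have /eqP := form0.
rewrite paddr_eq0 ?sqr_ge0 ?scaled_laplacian_form_ge0 // sqrf_eq0.
move=> /andP[/eqP vAv /eqP vw].
have [W [WC W0 Wconn LBE]] := hLB.
have cst i j : (v *m D) 0 i = (v *m D) 0 j.
  apply: (laplacian_form_eq0 WC W0 Wconn).
  by rewrite -LBE -scaled_laplacian_form.
(* The first vanishing makes [v] a multiple of [w^T]; orthogonality to [w] then forces the multiple
   to be 0, because the sum of the [r j] is positive. *)
have vE i j : v 0 j = (v *m D) 0 i * Num.sqrt (r j).
  by rewrite (cst i j) mul_mx_diag !mxE mulfVK.
have /rV0Pn[i vi0] := v0.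
have : (v *m D) 0 i * \sum_j r j = 0.
  rewrite -[RHS]vw [RHS]mxE mulr_sumr; apply: eq_bigr => j _.
  by rewrite [v 0 j](vE i) [w _ _]mxE -mulrA -expr2 sqr_sqrtr // ltW.
move/eqP; rewrite mulf_eq0 => /orP[/eqP x0|].
  by rewrite (vE i i) x0 mul0r eqxx in vi0.
rewrite psumr_eq0 => [/allP/(_ i (mem_index_enum _))/=|j _].
  by rewrite gt_eqF.
exact: ltW.
Qed.

Lemma scaled_laplacian_deflation :
  char_poly A * ('X - ((w^T *m w) 0 0)%:P) = 'X * char_poly (A + w *m w^T).
Proof. exact/char_poly_deflation/scaled_laplacian_kernel. Qed.

(** If ['X^2] divided [char_poly A], cancelling one ['X] in the deflation identity and evaluating at
    0 would give [\det (A + w w^T) = 0]. *)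
Lemma scaled_laplacian_root0_simple q : char_poly A <> q * 'X * 'X.
Proof.
move=> qE; have := scaled_laplacian_deflation; rewrite qE => /eqP.
rewrite -!mulrA mulrCA (inj_eq (mulfI _)) ?polyX_eq0 // => /eqP.
move=> /(congr1 (horner^~ 0)); rewrite hornerM hornerM hornerX mul0r mulr0.
rewrite horner_coef0 char_poly_det => /esym/eqP.
by rewrite mulf_eq0 signr_eq0 (negPf scaled_laplacian_deflated_unit).
Qed.

Hypothesis n_gt0 : (0 < n)%N.

Lemma scaled_laplacian_root0 : root (char_poly A) 0.
Proof.
have := scaled_laplacian_deflation => /(congr1 (horner^~ 0)).
rewrite !hornerM hornerX mul0r !hornerE => /eqP.
rewrite mulf_eq0 oppr_eq0 => /orP[//|].
(* At 0 the deflation identity reads [(char_poly A)(0) * (- |w|^2) = 0], so it remains to see that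
   [w] is nonzero. *)
have : 0 < (w^T *m w^T^T) 0 0.
  apply: rV_sqr_gt0; apply/rV0Pn; exists (Ordinal n_gt0).
  by rewrite !mxE.
by rewrite trmxK => /gt_eqF ->.
Qed.

End ScaledLaplacian.

Lemma ordered_eigenvalues_scaled_laplacian (R : realType) (n : nat)
    (LB : 'M[R]_n) (r : 'I_n -> R) (lambda : nat -> R) :
  (2 <= n)%N -> connected_laplacian LB -> (forall i, 0 < r i) ->
  ordered_eigenvalues (scaled_laplacian r LB) lambda ->
  lambda 1%N = 0 /\ (forall k, (2 <= k <= n)%N -> 0 < lambda k).
Proof.
move=> n2 hLB r0 [chi mono].
have n1 : (1 <= n)%N by apply: ltnW.
have l1 : lambda 1%N = 0.
  apply/eqP; rewrite eq_le; apply/andP; split.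
    (* The root 0 is one of the [lambda k], and [lambda 1] is the least of them. *)
    have := scaled_laplacian_root0 hLB r0 n1.
    rewrite chi -(big_map lambda predT (fun x => 'X - x%:P)) root_prod_XsubC.
    case/mapP=> k; rewrite mem_index_iota => /andP[k1 kn] ->.
    exact: mono.
  apply: (@scaled_laplacian_root_ge0 _ _ _ r hLB).
  by rewrite chi big_ltn // rootM root_XsubC eqxx.
(* Otherwise the first two factors of the product would both be ['X], against simplicity of the root
   0. *)
have l2 : lambda 2%N != 0.
  apply/eqP => l2; apply: (@scaled_laplacian_root0_simple _ _ _ _ hLB r0
    (\prod_(3 <= k < n.+1) ('X - (lambda k)%:P))).
  by rewrite chi big_ltn // big_ltn // l1 l2 subr0; ring.
split=> // k /andP[k2 kn]; apply: lt_le_trans (mono 2%N k _ _ _) => //.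
by rewrite lt0r l2 -l1 mono.
Qed.

(** * Loop algebra and transfer of poles *)

Lemma feedback_scalar_fold (F : fieldType) (g c m s : F) :
  s != 0 -> 1 + g * (- c) != 0 ->
  g / (1 + g * (m / s - c))
    = s * (g / (1 + g * (- c)) / s / (1 + m * (g / (1 + g * (- c)) / s))).
Proof.
(* [d] is the denominator of [zhat] at gain 0, where [0 / s - c] reduces to [- c]; factoring it out
   exposes the loop around [g / d / s]. *)
move=> s0 d0; set d := 1 + g * (- c).
have -> : 1 + g * (m / s - c) = d * (1 + m * (g / d / s)).
  have dK : d * (m * (g / d / s)) = m * (g / s).
    by rewrite mulrCA [g / d / s]mulrAC [d * _]mulrC divfK.
  by rewrite [RHS]mulrDr dK mulr1 mulrBr /d mulrN addrA addrAC [g * (m / s)]mulrCA.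
by rewrite [RHS]mulrA [s * _]mulrC divfK // invfM [LHS]mulrA.
Qed.

Section Poles.
Variable R : realType.
Implicit Types (f go co : {fraction {poly R}}) (p : R[i]).

Lemma laplace_var_neq0 : laplace_var R != 0.
Proof. by rewrite tofrac_eq0 polyX_eq0. Qed.

Lemma root_map_real_complex0 (b : {poly R}) :
  root (map_poly (real_complex R) b) 0 = root b 0.
Proof. by rewrite -(rmorph0 (real_complex R)) fmorph_root. Qed.

Lemma coprimepX (a : {poly R}) : coprimep a 'X = ~~ root a 0.
Proof. by rewrite -coprimep_XsubC subr0. Qed.

(** Multiplying by [s] can only cancel a pole at 0, and [f] has none. *)
Lemma is_pole_laplace_var_mul f p :
  ~ is_pole f 0 -> is_pole (laplace_var R * f) p <-> is_pole f p.
Proof.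
move=> f0; split=> -[a [b [b0 cab fE bp]]]; last first.
  exists ('X * a), b; split=> //; last by rewrite tofracM fE mulrA.
  rewrite coprimepMl cab andbT coprimep_sym coprimepX.
  apply/negP => rb; apply: f0; exists a, b.
  by rewrite root_map_real_complex0.
have {}fE : f = tofrac a / (laplace_var R * tofrac b).
  by rewrite invfM mulrCA -fE mulKf ?laplace_var_neq0.
(* Here [f = a / ('X * b)]. Either ['X] divides [a] and cancels, leaving the denominator [b], or the
   fraction is already reduced and [f] has a pole at 0, which is excluded. *)
have [/factor_theorem[a' aE]|ra] := boolP (root a 0).
  rewrite subr0 in aE; subst a.
  exists a', b; split=> //; first by move: cab; rewrite coprimepMl => /andP[].
  rewrite fE tofracM mulrC -/(laplace_var R) invfM [RHS]mulrC.
  by rewrite mulrAC [tofrac a' * _]mulrC mulKf ?laplace_var_neq0 // mulrC.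
case: f0; exists a, ('X * b); split.
- by rewrite mulf_neq0 ?polyX_eq0.
- by rewrite coprimepMr coprimepX ra.
- by rewrite fE tofracM.
- by rewrite root_map_real_complex0 rootM rootX eqxx.
Qed.

Lemma zhatE go co mu :
  zhat_den go co 0 != 0 ->
  zhat go co mu = laplace_var R * feedback (zhat go co 0 / laplace_var R) mu.
Proof.
rewrite /zhat /feedback /zhat_den /ratconst polyC0 tofrac0 mul0r sub0r => d0.
exact: feedback_scalar_fold laplace_var_neq0 d0.
Qed.

End Poles.

Theorem theorem1 (R : realType) (n : nat) (hn : (2 <= n)%N)
  (LB : 'M[R]_n) (hLB : connected_laplacian LB)
  (r : 'I_n -> R) (g c : 'I_n -> {fraction {poly R}})
  (go co : {fraction {poly R}}) (hgo : go != 0)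
  (hprop : proportional r g c go co)
  (lambda : nat -> R)
  (hlambda : ordered_eigenvalues (scaled_laplacian r LB) lambda)
  (hwd_z : forall k : nat, (1 <= k <= n)%N -> zhat_den go co (lambda k) != 0)
  (hwd_F : forall mu : R, 0 < mu ->
     feedback_wd (zhat go co (lambda 1%N) / laplace_var R) mu)
  (hstable : forall mu : R, 0 < mu -> forall p : R[i],
     is_pole (feedback (zhat go co (lambda 1%N) / laplace_var R) mu) p ->
     complex.Re p < 0) :
  forall k : nat, (2 <= k <= n)%N -> forall p : R[i],
    (is_pole (zhat go co (lambda k)) p <->
     yields_gain (zhat go co (lambda 1%N) / laplace_var R) (lambda k) p) /\
    (is_pole (zhat go co (lambda k)) p <->
     is_pole (feedback (zhat go co (lambda 1%N) / laplace_var R) (lambda k)) p).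
Proof.
have r0 i : 0 < r i by case: (hprop i).
have [l1 lpos] := ordered_eigenvalues_scaled_laplacian hn hLB r0 hlambda.
move=> k hk p; have lk := lpos k hk.
have d0 : zhat_den go co 0 != 0 by rewrite -l1; apply/hwd_z/ltnW.
suff zF : is_pole (zhat go co (lambda k)) p <->
    is_pole (feedback (zhat go co (lambda 1%N) / laplace_var R) (lambda k)) p.
  by split=> //; rewrite /yields_gain zF; split=> [|[]].
rewrite (zhatE _ d0) -l1. apply: is_pole_laplace_var_mul.
(* A pole at 0 would have real part 0, contradicting stability at the gain [lambda k > 0]. *)
by move=> /(hstable _ lk); rewrite ltxx.
Qed.
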